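(* Let $-\infty\le a<b\le\infty$. Let $A,B,C:[a,b]\to\mathbb{R}$ be such that two of the three functions are of bounded variation on $[a,b]$ and the other is regulated on $[a,b]$. If $B$ and $C$ have no common point of discontinuity then $$\int_a^b A\,d[BC]=\int_a^b AB\,dC+\int_a^b AC\,dB,$$ where the integrals are Henstock--Stieltjes integrals.
   Context: A function $f$ is regulated on $[a,b]$ if $\lim_{t\to x^-}f(t)$ exists in $\mathbb{R}$ for every $x\in(a,b]$ and $\lim_{t\to y^+}f(t)$ exists in $\mathbb{R}$ for every $y\in[a,b)$; a function given on $(a,b)$ is extended to $[a,b]$ by these limits at the endpoints (in particular at $\pm\infty$ if these are endpoints). A function $f$ is of bounded variation on $[a,b]$ if the sums $\sum_{n=1}^N|f(x_n)-f(x_{n-1})|$ are bounded over all partitions $a=x_0<x_1<\dots<x_N=b$. Henstock--Stieltjes integral: a tagged partition of $[a,b]$ is a finite collection $\{([x_{n-1},x_n],z_n)\}_{n=1}^N$ with $a=x_0<x_1<\dots<x_N=b$ and $z_n\in[x_{n-1},x_n]$. A gauge is a function $\gamma$ assigning to each $z\in[a,b]$ an open interval $\gamma(z)$ in $[a,b]$ containing $z$, where intervals $[a,u)$, $(u,v)$, $(u,b]$ with $u,v\in(a,b)$ count as open (a two-point compactification if $a=-\infty$, $b=\infty$). The tagged partition is $\gamma$-fine if $[x_{n-1},x_n]\subset\gamma(z_n)$ for all $n$. For $f,g:[a,b]\to\mathbb{R}$, the integral $\int_a^b f\,dg$ exists and equals $I\in\mathbb{R}$ if for every $\epsilon>0$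 there is a gauge $\gamma$ such that $\left|\sum_{n=1}^N f(z_n)[g(x_n)-g(x_{n-1})]-I\right|<\epsilon$ for every $\gamma$-fine tagged partition. *)

(* Defs.v *)
From HB Require Import structures.
From mathcomp Require Import all_boot all_order all_algebra.
From mathcomp Require Import all_classical all_reals all_analysis.

Set Implicit Arguments.
Unset Strict Implicit.
Unset Printing Implicit Defensive.

Import Order.TTheory GRing.Theory Num.Theory.
Import numFieldNormedType.Exports.

Local Open Scope classical_set_scope.
Local Open Scope ring_scope.

(* A function [a, b] -> R with -oo <= a < b <= +oo is represented by a total
   function \bar R -> R of which only the values on [a, b] are ever used.  The
   values at the endpoints, infinite or not, are arbitrary real numbers.
   Neighbourhoods are those of \bar R, so that [-oo, +oo] is the two-point
   compactification of R. *)

Section extended_interval.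
Context {R : realType}.
Implicit Types (a b : \bar R) (f g : \bar R -> R).

Definition regulated a b f : Prop :=
  (forall x : \bar R, (a < x <= b)%E ->
     exists l : R, f @ within `[a, x[ (nbhs x) --> l) /\
  (forall y : \bar R, (a <= y < b)%E ->
     exists l : R, f @ within `]y, b] (nbhs y) --> l).

Definition discontinuous_at a b f (x : \bar R) : Prop :=
  ~ (f @ within `[a, b] (nbhs x) --> f x).

(* The library's variation and bounded_variation only cover finite a and b.
   As there, s lists the partition points other than a, so that the points are
   x_n = nth b (a :: s) n for 0 <= n <= size s. *)
Definition evariation a b f (s : seq (\bar R)) : R :=
  let F := f \o nth b (a :: s) in
  \sum_(0 <= n < size s) `|F n.+1 - F n|.

Definition ebounded_variation a b f : Prop :=
  has_ubound [set evariation a b f s | s in itv_partition a b].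

Definition open_subinterval a b (U : set (\bar R)) : Prop :=
  exists u v : \bar R, [/\ (a < u < b)%E, (a < v < b)%E &
    [\/ U = `[a, u[%classic, U = `]u, v[%classic | U = `]u, b]%classic ] ].

Definition gauge a b (gamma : \bar R -> set (\bar R)) : Prop :=
  forall z, (a <= z <= b)%E -> open_subinterval a b (gamma z) /\ gamma z z.

(* z n is the tag of [x_n, x_(n+1)]; its values for n >= size s are
   irrelevant. *)
Definition tagged_partition a b (s : seq (\bar R)) (z : nat -> \bar R) : Prop :=
  itv_partition a b s /\
  let x := nth b (a :: s) in
  forall n, (n < size s)%N -> (x n <= z n <= x n.+1)%E.

Definition fine_for a b (gamma : \bar R -> set (\bar R))
    (s : seq (\bar R)) (z : nat -> \bar R) : Prop :=
  let x := nth b (a :: s) in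
  forall n, (n < size s)%N -> `[x n, x n.+1] `<=` gamma (z n).

Definition stieltjes_sum a b f g (s : seq (\bar R)) (z : nat -> \bar R) : R :=
  let x := nth b (a :: s) in
  \sum_(0 <= n < size s) f (z n) * (g (x n.+1) - g (x n)).

(* "the integral of f dg over [a, b] exists and equals I" *)
Definition is_HS_integral a b f g (I : R) : Prop :=
  forall eps : R, 0 < eps ->
  exists gamma, gauge a b gamma /\
    forall s z, tagged_partition a b s z -> fine_for a b gamma s z ->
      `|stieltjes_sum a b f g s z - I| < eps.

End extended_interval.

(* Main.v *)
Require Import Defs.
From HB Require Import structures.
From mathcomp Require Import all_boot all_order all_algebra.
From mathcomp Require Import all_classical all_reals all_analysis.
From mathcomp Require Import ring lra.
Import Order.TTheory GRing.Theory Num.Theory.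
Import numFieldNormedType.Exports.
Local Open Scope classical_set_scope.
Local Open Scope ring_scope.

(** For a subinterval [[x, y]] with tag [z], the elementary identity
    [B y * C y - B x * C x = B z * (C y - C x) + C z * (B y - B x)
       + (B y - B z) * (C y - C z) - (B x - B z) * (C x - C z)]
    turns the Riemann sums of [A d(BC)] into those of [AB dC] plus those of
    [AC dB] plus sums of products of two increments.  Two facts therefore
    suffice: the two integrals on the right exist, and the sums of products
    tend to zero.

    Sums of products ([joint_increments_cvg0]).  Say that [B] has bounded
    variation and [C] is regulated.  Given [delta], the increments of [C] from
    a tag are locally at most [delta] outside a finite set [F] of tags
    ([regulated_finite_jumps]), and near these tags the sums are at most
    [delta] times the variation of [B].  At a point of [F] either [C] is
    continuous, and the same bound holds, or [B] is, and the increments of [B]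
    can be made as small as desired; a point tags at most two intervals, so
    that the finite set [F] contributes little.

    Existence.  The integral of [f dg] exists when one of [f], [g] is regulated
    and the other has bounded variation.  Regulated functions are uniform
    limits of linear combinations of indicators of initial segments, whence the
    induction principle [regulated_ind].  For an indicator the integral is
    computed by hand, with a gauge that forces the jump to be a tag.  The
    existence passes to uniform limits of [f] because the sums are bounded by
    [sup |f|] times the variation of [g], and to uniform limits of [g] by
    the same bound after a summation by parts.

    Gauges given by neighbourhoods in the extended line generate a filter on
    tagged partitions, and the integral is the limit of the sums along it
    ([is_HS_integralP]); linearity and completeness then come from the theory
    of filters.  All estimates on sums have one form: if each term is at most
    the increment of a function [W], the sum is at most [W b - W a]
    ([near_interval_sum_le]).  A function of bounded variation enters
    through such a [W], its variation function ([dominated]), and so does the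
    number of intervals that have a given tag ([passage_count]). *)

Set Implicit Arguments.
Unset Strict Implicit.
Unset Printing Implicit Defensive.

(** * Neighbourhoods in the extended line *)

Section extended_line.
Context {R : realType}.
Implicit Types (a b z : \bar R) (N : set (\bar R)).

Lemma ereal_between a b : (a < b)%E -> exists c, (a < c < b)%E.
Proof.
case: a => [r| |]; case: b => [s| |] //=.
- rewrite lte_fin => rs; exists ((r + s) / 2)%:E; rewrite !lte_fin.
  by rewrite !midf_lt.
- by move=> _; exists (r + 1)%:E; rewrite lte_fin ltrDl ltr01 ltry.
- by move=> _; exists (s - 1)%:E; rewrite lte_fin ltNyr gtrBl ltr01.
- by move=> _; exists 0%:E; rewrite ltNyr ltry.
Qed.

Lemma nbhs_left_itv a z N : nbhs z N -> (a < z)%E ->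
  exists u, (a < u < z)%E /\ forall t, (u < t <= z)%E -> N t.
Proof.
rewrite itv_nbhsE /= => -[i [oi zi] iN] az.
case: i oi zi iN => l r oi zi iN.
have [u [/andP[au uz] lu]] : exists u, (a < u < z)%E /\
    (forall t, (u < t)%E -> (l <= BLeft t)%O).
  case: l oi zi iN => [d l0|d] oi zi iN.
    have dE := itv_open_ends_lside oi; subst d.
    have l0z : (l0 < z)%E by move: zi; rewrite itv_boundlr => /andP[].
    have [c /andP[mc cz]] : exists c, (maxe a l0 < c < z)%E.
      by apply: ereal_between; rewrite gt_max az l0z.
    move: mc; rewrite gt_max => /andP[ac lc].
    by exists c; rewrite ac cz; split=> // t ct; rewrite bnd_simp (lt_trans lc).
  have [c acz] := ereal_between az.
  by exists c; split=> // t _; rewrite (itv_open_ends_linfty oi).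
exists u; rewrite au uz; split=> // t /andP[ut tz].
apply: iN; rewrite /= itv_boundlr lu //=.
move: zi; rewrite itv_boundlr => /andP[_ ].
by apply: le_trans; rewrite bnd_simp.
Qed.

Lemma nbhs_right_itv b z N : nbhs z N -> (z < b)%E ->
  exists v, (z < v < b)%E /\ forall t, (z <= t < v)%E -> N t.
Proof.
rewrite itv_nbhsE /= => -[i [oi zi] iN] zb.
case: i oi zi iN => l r oi zi iN.
have [v [/andP[zv vb] rv]] : exists v, (z < v < b)%E /\
    (forall t, (t < v)%E -> (BRight t <= r)%O).
  case: r oi zi iN => [d r0|d] oi zi iN.
    have dE := itv_open_ends_rside oi; subst d.
    have zr0 : (z < r0)%E by move: zi; rewrite itv_boundlr => /andP[].
    have [c /andP[zc cm]] : exists c, (z < c < mine b r0)%E.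
      by apply: ereal_between; rewrite lt_min zb zr0.
    move: cm; rewrite lt_min => /andP[cb cr].
    by exists c; rewrite zc cb; split=> // t ct; rewrite bnd_simp (lt_trans ct).
  have [c acz] := ereal_between zb.
  by exists c; split=> // t _; rewrite (itv_open_ends_rinfty oi).
exists v; rewrite zv vb; split=> // t /andP[zt tv].
apply: iN; rewrite /= itv_boundlr rv // andbT.
move: zi; rewrite itv_boundlr => /andP[+ _].
by move/le_trans; apply; rewrite bnd_simp.
Qed.

Lemma nbhs_gt_ereal a z : (a < z)%E -> \forall t \near z, (a < t)%E.
Proof.
by move=> az; apply: open_nbhs_nbhs; split=> //; exact: open_ereal_gt_ereal.
Qed.

Lemma nbhs_lt_ereal b z : (z < b)%E -> \forall t \near z, (t < b)%E.
Proof.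
by move=> zb; apply: open_nbhs_nbhs; split=> //; exact: open_ereal_lt_ereal.
Qed.

(** Cousin's lemma, phrased for a transitive relation: what holds on all small
    intervals around each point holds on [[a, b]].  The supremum of the [t]
    such that [P a t] holds is attained and cannot be less than [b]. *)
Lemma interval_induction a b (P : \bar R -> \bar R -> Prop) : (a < b)%E ->
  (forall x y z, P x y -> P y z -> P x z) ->
  (forall z, (a <= z <= b)%E -> exists2 N, nbhs z N &
     forall x y, (a <= x <= z)%E -> (z <= y <= b)%E -> (x < y)%E ->
       (forall t, (x <= t <= y)%E -> N t) -> P x y) ->
  P a b.
Proof.
move=> ab Ptrans Ploc.
pose S := [set t | (a < t <= b)%E /\ P a t]; pose s := ereal_sup S.
have sb : (s <= b)%E by apply: ge_ereal_sup => t [/andP[]].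
have [N aN PN] := Ploc a ltac:(by rewrite lexx ltW).
have [v [/andP[av vb] vN]] := nbhs_right_itv aN ab.
have [c /andP[ac cv]] := ereal_between av.
have as_ : (a < s)%E.
  apply: (lt_le_trans ac); apply: ereal_sup_ubound; split.
    by rewrite ac (ltW (lt_trans cv vb)).
  apply: PN; rewrite ?lexx ?(ltW ac) ?(ltW (lt_trans cv vb))//.
  by move=> t /andP[at_ tc]; apply: vN; rewrite at_ (le_lt_trans tc).
have [M sM PM] := Ploc s ltac:(by rewrite sb ltW).
have [u [/andP[au us] uM]] := nbhs_left_itv sM as_.
have Pas : P a s.
  have [t [/andP[at_ tb] Pat] ut] := ereal_sup_gt us.
  have ts : (t <= s)%E by apply: ereal_sup_ubound; split=> //; rewrite at_.
  move: ts; rewrite le_eqVlt => /predU1P[<-//|ts].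
  apply: (Ptrans _ _ _ Pat); apply: PM;
    rewrite ?lexx ?sb ?(ltW at_) ?(ltW ts)//.
  by move=> q /andP[tq qs]; apply: uM; rewrite (lt_le_trans ut).
move: sb; rewrite le_eqVlt => /predU1P[<-//|sb].
have [w [/andP[sw wb] wM]] := nbhs_right_itv sM sb.
have [d /andP[sd dw]] := ereal_between sw.
have db : (d <= b)%E by rewrite (ltW (lt_trans dw wb)).
suff : (d <= s)%E by rewrite leNgt sd.
apply: ereal_sup_ubound; split; first by rewrite (lt_trans as_ sd).
apply: (Ptrans _ _ _ Pas); apply: PM; rewrite ?lexx ?(ltW as_) ?(ltW sd)//.
by move=> t /andP[st td]; apply: wM; rewrite st (le_lt_trans td).
Qed.
End extended_line.

(** * Riemann sums along the filter of tagged partitions *)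

Section tagged_partitions.
Context {R : realType}.
Implicit Types (a b : \bar R) (f g : \bar R -> R) (W : \bar R -> R).

(** Completeness: a function that is within every [eps] of a convergent one is
    Cauchy.  The filter need not be proper, and then every number is a limit;
    this frees the users from showing that fine tagged partitions exist. *)
Lemma cvg_near_limit (T : Type) (F : set_system T) {FF : Filter F}
    (u : T -> R) :
  (forall eps : R, 0 < eps -> exists v : T -> R,
     (exists l : R, v @ F --> l) /\ \forall p \near F, `|u p - v p| <= eps) ->
  exists l : R, u @ F --> l.
Proof.
move=> Huv.
have [F0|F0] := pselect (F set0).
  by exists 0; apply/cvgrPdist_lt => e _; apply: filterS F0 => ?.
have PF : ProperFilter F by split.
suff /cauchy_cvgP : cauchy (u @ F) by move=> cu; exists (lim (u @ F)).
apply: cauchy_exP => eps eps0.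
have eps2 : 0 < eps / 2 by rewrite divr_gt0.
have [v [[l /cvgrPdist_lt vl] uv]] := Huv _ eps2.
exists l; move: (vl _ eps2); apply: filterS2 uv => p uv vl'.
rewrite /= /ball /= (splitr eps) (le_lt_trans (ler_distD (v p) _ _))//.
by rewrite [`|v p - _|]distrC ltr_leD.
Qed.

Lemma open_subinterval_nbhs a b z (U : set (\bar R)) :
  (a <= z <= b)%E -> open_subinterval a b U -> U z ->
  nbhs z (fun t => (a <= t <= b)%E -> U t).
Proof.
move=> /andP[az zb] [u [v [/andP[au ub] /andP[av vb] UE]]] Uz.
case: UE => UE; move: Uz; rewrite UE /= in_itv /=.
- move=> /andP[_ zu]; apply: filterS (nbhs_lt_ereal zu) => t tu /andP[at_ _].
  by rewrite /= in_itv /= at_.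
- move=> /andP[uz zv].
  apply: filterS2 (nbhs_gt_ereal uz) (nbhs_lt_ereal zv) => t ut tv _.
  by rewrite /= in_itv /= ut.
- move=> /andP[uz _]; apply: filterS (nbhs_gt_ereal uz) => t ut /andP[_ tb].
  by rewrite /= in_itv /= ut.
Qed.

Lemma nbhs_open_subinterval a b z (N : set (\bar R)) : (a < b)%E ->
  (a <= z <= b)%E -> nbhs z N ->
  exists U, [/\ open_subinterval a b U, U z & U `<=` N].
Proof.
move=> ab /andP[]; rewrite le_eqVlt => /predU1P[<- _|az].
  move=> /nbhs_right_itv-/(_ _ ab)[v [/andP[av vb] vN]].
  exists `[a, v[%classic; split; last by move=> t /=; rewrite in_itv; exact: vN.
    by exists v, v; rewrite av vb; split=> //; constructor 1.
  by rewrite /= in_itv /= lexx.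
rewrite le_eqVlt => /predU1P[zb|zb].
  subst z; move=> /nbhs_left_itv-/(_ _ az)[u [/andP[au ub] uN]].
  exists `]u, b]%classic; split; last by move=> t /=; rewrite in_itv; exact: uN.
    by exists u, u; rewrite au ub; split=> //; constructor 3.
  by rewrite /= in_itv /= lexx ub.
move=> Nz.
have [u [/andP[au uz] uN]] := nbhs_left_itv Nz az.
have [v [/andP[zv vb] vN]] := nbhs_right_itv Nz zb.
exists `]u, v[%classic; split.
- exists u, v; rewrite au vb (lt_trans uz zb) (lt_trans az zv).
  by split=> //; constructor 2.
- by rewrite /= in_itv /= uz.
- move=> t /=; rewrite in_itv /= => /andP[ut tv].
  have [tz|/ltW zt] := leP t z; first by apply: uN; rewrite ut.
  by apply: vN; rewrite zt.
Qed.

(** A gauge is replaced by a choice of neighbourhoods, which can be intersected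
    at will, unlike the three shapes of open subintervals. *)
Definition tagged_filter a b : set_system (seq (\bar R) * (nat -> \bar R)) :=
  [set P | exists2 G : \bar R -> set (\bar R), forall z, nbhs z (G z) &
     forall s z, tagged_partition a b s z -> fine_for a b G s z -> P (s, z)].

#[global] Instance tagged_filter_filter a b : Filter (tagged_filter a b).
Proof.
split.
- by exists (fun _ => setT) => // z; exact: filterT.
- move=> P Q [G Gn GP] [H Hn HQ].
  exists (fun z => G z `&` H z) => [z|s z tp sz]; first exact: filterI.
  by split; [apply: GP|apply: HQ] => // x n ns t tn; have [] := sz n ns t tn.
- by move=> P Q PQ [G Gn GP]; exists G => // s z tp sz; apply/PQ/GP.
Qed.

Lemma is_HS_integralP a b f g (I : R) : (a < b)%E ->
  is_HS_integral a b f g I <->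
  stieltjes_sum a b f g p.1 p.2 @[p --> tagged_filter a b] --> I.
Proof.
move=> ab; split.
- move=> fgI; apply/cvgrPdist_lt => eps eps0.
  have [gamma [gg gI]] := fgI _ eps0.
  pose G z := if (a <= z <= b)%E then
    [set t | (a <= t <= b)%E -> gamma z t] else setT.
  exists G => [z|s z tp sz].
    rewrite /G; case: ifPn => zab; last exact: filterT.
    by have [? ?] := gg _ zab; exact: open_subinterval_nbhs.
  rewrite distrC; apply: gI => // x n ns t tn.
  have [ps tz] := tp.
  have /andP[xz zy] := tz _ ns.
  have ax := itv_partition_nth_ge (ltnW ns : (n < (size s).+1)%N) ps.
  have yb := itv_partition_nth_le (ns : (n.+1 < (size s).+1)%N) ps.
  have := sz _ ns _ tn; rewrite /G (le_trans ax xz) (le_trans zy yb) /=; apply.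
  move: tn; rewrite /= in_itv /= => /andP[xt ty].
  by rewrite (le_trans ax xt) (le_trans ty yb).
- move=> /cvgrPdist_lt fgI eps /fgI [G Gn GI].
  have /choice[gamma gP] z : exists U, (a <= z <= b)%E ->
      [/\ open_subinterval a b U, U z & U `<=` G z].
    have [zab|_] := boolP (a <= z <= b)%E; last by exists setT.
    by have [U ?] := nbhs_open_subinterval ab zab (Gn z); exists U.
  exists gamma; split=> [z /gP[]//|s z tp sz].
  rewrite distrC; apply: GI => // x n ns.
  have [ps tz] := tp; have /andP[xz zy] := tz _ ns.
  have ax := itv_partition_nth_ge (ltnW ns : (n < (size s).+1)%N) ps.
  have yb := itv_partition_nth_le (ns : (n.+1 < (size s).+1)%N) ps.
  apply: (subset_trans (sz _ ns)).
  by have [] // := gP (z n); rewrite (le_trans ax xz) (le_trans zy yb).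
Qed.

(** Besides the sums [f z * (g y - g x)], the proof sums increments of functions
    and products of increments; all are sums of some [e x z y]. *)
Definition interval_sum a b (e : \bar R -> \bar R -> \bar R -> R)
    (p : seq (\bar R) * (nat -> \bar R)) : R :=
  let x := nth b (a :: p.1) in
  \sum_(0 <= n < size p.1) e (x n) (p.2 n) (x n.+1).

(** The bounds telescope.  Of an interval that is fine for its tag, only the
    endpoints are used. *)
Lemma near_interval_sum_le a b e W (G : \bar R -> set (\bar R)) :
  (forall z, nbhs z (G z)) ->
  (forall x z y, (a <= x <= z)%E -> (z <= y <= b)%E -> (x < y)%E ->
     G z x -> G z y -> `|e x z y| <= W y - W x) ->
  \forall p \near tagged_filter a b, `|interval_sum a b e p| <= W b - W a.
Proof.
move=> Gn eW; exists G => // s z [ps tz] sz.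
rewrite /interval_sum /= (le_trans (ler_norm_sum _ _ _))//.
have -> : W b - W a = \sum_(0 <= n < size s)
   (W (nth b (a :: s) n.+1) - W (nth b (a :: s) n)).
  rewrite (telescope_sumr (fun n => W (nth b (a :: s) n))) //=.
  by rewrite (itv_partition_nth_size _ ps).
rewrite big_nat [leRHS]big_nat; apply: ler_sum => n /andP[_ ns].
have ax := itv_partition_nth_ge (ltnW ns : (n < (size s).+1)%N) ps.
have yb := itv_partition_nth_le (ns : (n.+1 < (size s).+1)%N) ps.
have /andP[xz zy] := tz _ ns.
have xy : (nth b (a :: s) n < nth b (a :: s) n.+1)%E.
  by have [/pathP->] := ps.
apply: eW; rewrite ?ax ?yb ?xz ?zy //.
- by apply: (sz _ ns); rewrite /= in_itv /= lexx ltW.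
- by apply: (sz _ ns); rewrite /= in_itv /= lexx ltW.
Qed.

Lemma interval_sumB a b e1 e2 p :
  interval_sum a b e1 p - interval_sum a b e2 p =
  interval_sum a b (fun x z y => e1 x z y - e2 x z y) p.
Proof. by rewrite /interval_sum sumrB. Qed.

Lemma interval_sum_lin a b k e1 e2 p :
  interval_sum a b (fun x z y => e1 x z y + k * e2 x z y) p =
  interval_sum a b e1 p + k * interval_sum a b e2 p.
Proof. by rewrite /interval_sum big_split mulr_sumr. Qed.

Lemma near_interval_sum_primitive a b e phi W (G : \bar R -> set (\bar R)) :
  (forall z, nbhs z (G z)) ->
  (forall x z y, (a <= x <= z)%E -> (z <= y <= b)%E -> (x < y)%E ->
     G z x -> G z y -> `|e x z y - (phi y - phi x)| <= W y - W x) ->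
  \forall p \near tagged_filter a b,
    `|interval_sum a b e p - (phi b - phi a)| <= W b - W a.
Proof.
move=> Gn eW; have [H Hn HP] := near_interval_sum_le Gn eW.
exists H => // s z tp sz; have := HP _ _ tp sz; rewrite -interval_sumB.
congr (`|_ - _| <= _); rewrite /interval_sum.
rewrite (telescope_sumr (fun n => phi (nth b (a :: s) n))) //=.
by rewrite (itv_partition_nth_size _ tp.1).
Qed.

(** The converse half of Henstock's lemma: a function [phi] whose increments
    approximate the terms is an indefinite integral. *)
Lemma variational_cvg a b e (phi : \bar R -> R) :
  (forall eps : R, 0 < eps ->
     exists (W : \bar R -> R) (G : \bar R -> set (\bar R)),
     [/\ W b - W a <= eps, forall z, nbhs z (G z) &
      forall x z y, (a <= x <= z)%E -> (z <= y <= b)%E -> (x < y)%E ->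
        G z x -> G z y -> `|e x z y - (phi y - phi x)| <= W y - W x]) ->
  interval_sum a b e p @[p --> tagged_filter a b] --> phi b - phi a.
Proof.
move=> He; apply/cvgrPdist_le => eps /He[W [G [Weps Gn eW]]].
apply: filterS (near_interval_sum_primitive Gn eW) => p.
by rewrite distrC => /le_trans; apply.
Qed.

End tagged_partitions.

(** * Regulated functions and functions of bounded variation *)

Section regulated_and_bv.
Context {R : realType}.
Implicit Types (a b : \bar R) (f g V : \bar R -> R).

(** Bounded variation in a usable form: [V] plays the part of the variation
    function, and no partition is mentioned. *)
Definition dominated a b f V : Prop := forall s t : \bar R,
  (a <= s)%E -> (s <= t)%E -> (t <= b)%E -> `|f t - f s| <= V t - V s.

Lemma evariation_cons a b f x s :
  evariation a b f (x :: s) = `|f x - f a| + evariation x b f s.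
Proof. by rewrite /evariation /= big_nat_recl. Qed.

Lemma evariation_rcons a s t f p : itv_partition a s p ->
  evariation a t f (rcons p t) = evariation a s f p + `|f t - f s|.
Proof.
elim: p a => [a /itv_partition_nil <-|x p IH a xp].
  by rewrite evariation_cons /evariation /= !big_geq // addr0 add0r.
by rewrite rcons_cons !evariation_cons (IH _ (itv_partition_cons xp)) addrA.
Qed.

(** [V t] is the variation of [f] on [[a, t]]; appending [t] to a partition of
    [[a, s]] gives a partition of [[a, t]]. *)
Lemma bounded_variation_dominated a b f : ebounded_variation a b f ->
  exists V, dominated a b f V.
Proof.
move=> [M /= MB].
pose S t := [set evariation a t f p | p in itv_partition a t].
have Srcons s t p : (s < t)%E -> itv_partition a s p ->
    itv_partition a t (rcons p t).
  move=> st ps; rewrite -cats1; apply: (itv_partition_cat ps).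
  exact: itv_partition1.
have ubS t : (t <= b)%E -> has_ubound (S t).
  rewrite le_eqVlt => /predU1P[->|tb]; first by exists M.
  exists M => _ [p pt <-]; apply: le_trans (MB _ _); last first.
    by exists (rcons p b); first exact: (Srcons _ _ _ tb pt).
  by rewrite (evariation_rcons _ _ pt) lerDl.
exists (fun t => sup (S t)) => s t as_ st tb.
move: st; rewrite le_eqVlt => /predU1P[->|st]; first by rewrite !subrr normr0.
rewrite lerBrDr addrC -lerBrDr; apply: ge_sup.
  move: as_; rewrite le_eqVlt => /orP[/= as_|as_].
    by exists (evariation a s f [::]); exists [::].
  by exists (evariation a s f [:: s]); exists [:: s] => //;
    exact: itv_partition1.
move=> _ [p ps <-]; rewrite lerBrDr.
apply: ub_le_sup; first exact: ubS.
exists (rcons p t); first exact: (Srcons _ _ _ st ps).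
exact: evariation_rcons.
Qed.

Lemma dominated_le a b f V s t : dominated a b f V -> (a <= s)%E ->
  (s <= t)%E -> (t <= b)%E -> V s <= V t.
Proof.
by move=> fV as_ st tb; rewrite -subr_ge0 (le_trans _ (fV _ _ as_ st tb)).
Qed.

Definition bounded_on a b f : Prop :=
  exists2 M : R, 0 < M & forall t : \bar R, (a <= t <= b)%E -> `|f t| <= M.

Lemma dominated_bounded a b f V : dominated a b f V -> bounded_on a b f.
Proof.
move=> fV; exists (`|V b - V a| + `|f a| + 1) => [|t /andP[at_ tb]].
  by rewrite ltr_wpDl// addr_ge0.
rewrite -[f t](subrK (f a)) (le_trans (ler_normD _ _))//.
rewrite ler_wpDr// lerD2r (le_trans (fV _ _ _ at_ tb)) ?lexx//.
rewrite (le_trans _ (ler_norm _))// lerD2r.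
exact: (dominated_le fV).
Qed.

Lemma dominated_mul a b f g V W : dominated a b f V -> dominated a b g W ->
  exists U, dominated a b (f \* g) U.
Proof.
move=> fV gW; have [M M0 fM] := dominated_bounded fV.
have [N N0 gN] := dominated_bounded gW.
exists (fun t => M * W t + N * V t) => s t as_ st tb /=.
have -> : f t * g t - f s * g s = f t * (g t - g s) + g s * (f t - f s) by ring.
have -> : M * W t + N * V t - (M * W s + N * V s) =
  M * (W t - W s) + N * (V t - V s) by ring.
rewrite (le_trans (ler_normD _ _))// !normrM lerD// ler_pM//.
- by apply: fM; rewrite (le_trans as_).
- exact: gW.
- by apply: gN; rewrite as_ (le_trans st).
- exact: fV.
Qed.

(** The monotone function [V] has one-sided limits, namely a supremum and an
    infimum, so that [f] is Cauchy on each side of a point. *)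
Lemma dominated_regulated a b f V : dominated a b f V -> regulated a b f.
Proof.
move=> fV; split=> [x /andP[ax xb]|y /andP[ay yb]].
- apply: cvg_near_limit => eps eps0.
  pose S := [set V u | u in `[a, x[%classic].
  have hS : has_sup S.
    split; first by exists (V a), a; rewrite //= in_itv /= lexx.
    exists (V x) => _ [u /= + <-]; rewrite in_itv /= => /andP[au ux].
    by apply: (dominated_le fV) => //; exact: ltW.
  have [_ [u /= + <-] Vu] := sup_adherent eps0 hS.
  rewrite in_itv /= => /andP[au ux].
  exists (fun _ => f u); split; first by exists (f u); exact: cvg_cst.
  apply: filterS (nbhs_gt_ereal ux) => t ut /=.
  rewrite in_itv /= => /andP[at_ tx].
  have tb : (t <= b)%E by rewrite (le_trans (ltW tx)).
  rewrite (le_trans (fV _ _ au (ltW ut) tb))// lerBlDr.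
  rewrite (@le_trans _ _ (sup S))//; last by rewrite addrC -lerBlDr ltW.
  apply: ub_le_sup; first by case: hS.
  by exists t; rewrite //= in_itv /= at_.
- apply: cvg_near_limit => eps eps0.
  pose S := [set V u | u in `]y, b]%classic].
  have hS : has_inf S.
    split; first by exists (V b), b; rewrite //= in_itv /= lexx yb.
    exists (V y) => _ [u /= + <-]; rewrite in_itv /= => /andP[yu ub].
    by apply: (dominated_le fV) => //; exact: ltW.
  have [_ [u /= + <-] Vu] := inf_adherent eps0 hS.
  rewrite in_itv /= => /andP[yu ub].
  exists (fun _ => f u); split; first by exists (f u); exact: cvg_cst.
  apply: filterS (nbhs_lt_ereal yu) => t tu /=.
  rewrite in_itv /= => /andP[yt tb].
  have at_ : (a <= t)%E by rewrite (le_trans ay (ltW yt)).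
  rewrite distrC (le_trans (fV _ _ at_ (ltW tu) ub))// lerBlDr.
  rewrite (le_trans (ltW Vu))// addrC lerD2l.
  apply: ge_inf; first by case: hS.
  by exists t; rewrite //= in_itv /= tb yt.
Qed.

Lemma regulated_mul a b f g : regulated a b f -> regulated a b g ->
  regulated a b (f \* g).
Proof.
move=> [fl fr] [gl gr]; split=> [x xab|y yab].
  have [l ?] := fl _ xab; have [m ?] := gl _ xab.
  by exists (l * m); exact: cvgM.
have [l ?] := fr _ yab; have [m ?] := gr _ yab.
by exists (l * m); exact: cvgM.
Qed.

Lemma regulated_left a b f x : regulated a b f -> (a < x <= b)%E ->
  exists l : R, forall eps, 0 < eps ->
    \forall t \near x, (a <= t < x)%E -> `|f t - l| <= eps.
Proof.
move=> [fl _] /fl[l /cvgrPdist_le fxl]; exists l => eps /fxl xl.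
have {}xl : \forall t \near x, [set` `[a, x[] t -> `|l - f t| <= eps := xl.
by apply: filterS xl => t xl tax; rewrite distrC; apply: xl; rewrite /= in_itv.
Qed.

Lemma regulated_right a b f y : regulated a b f -> (a <= y < b)%E ->
  exists r : R, forall eps, 0 < eps ->
    \forall t \near y, (y < t <= b)%E -> `|f t - r| <= eps.
Proof.
move=> [_ fr] /fr[r /cvgrPdist_le fyr]; exists r => eps /fyr yr.
have {}yr : \forall t \near y, [set` `]y, b]] t -> `|r - f t| <= eps := yr.
by apply: filterS yr => t yr tyb; rewrite distrC; apply: yr; rewrite /= in_itv.
Qed.

(** Regulated functions are uniform limits of step functions: near a point [z],
    [f] is close to its left limit, to [f z] and to its right limit in turn,
    and [interval_induction] glues these local approximations. *)
Lemma regulated_ind a b (Q : (\bar R -> R) -> Prop) : (a < b)%E ->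
  (forall c : \bar R, Q (fun t => (t < c)%E%:R)) ->
  (forall c : \bar R, Q (fun t => (t <= c)%E%:R)) ->
  (forall k h1 h2, Q h1 -> Q h2 -> Q (fun t => h1 t + k * h2 t)) ->
  (forall f, (forall eps : R, 0 < eps -> exists2 h, Q h &
      forall t, (a <= t <= b)%E -> `|f t - h t| <= eps) -> Q f) ->
  forall f, regulated a b f -> Q f.
Proof.
move=> ab Qlt Qle Qlin Qapprox f rf; apply: Qapprox => eps eps0.
(* The step function approximates f on the half-open interval ]x, y] and
   vanishes elsewhere, so that gluing two of them is just addition. *)
pose P x y := (x <= y)%E /\ exists2 h, Q h & forall t,
  if (x < t <= y)%E then (`|f t - h t| <= eps : Prop) else h t = 0.
suff [_ [h Qh hP]] : P a b.
  exists (fun t => h t + f a * (t <= a)%E%:R); first exact: Qlin.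
  move=> t /andP[]; rewrite le_eqVlt => /predU1P[<- _|at_ tb].
    have := hP a; rewrite ltxx lexx /= => ->.
    by rewrite mulr1 add0r subrr normr0 ltW.
  by have := hP t; rewrite at_ tb (leNgt t a) at_ mulr0 addr0.
apply: interval_induction => //.
  move=> x y z [xy [h1 Q1 h1P]] [yz [h2 Q2 h2P]].
  split; first exact: le_trans yz.
  exists (fun t => h1 t + 1 * h2 t) => [|t]; first exact: Qlin.
  rewrite mul1r; have := h1P t; have := h2P t.
  have [ty|yt] /= := leP t y.
    by rewrite (le_trans ty yz) !andbT => ->; rewrite addr0.
  by rewrite (le_lt_trans xy yt) andbF => + ->; rewrite add0r.
move=> z /andP[az zb].
have [r rP] : exists r : R,
    \forall t \near z, (z < t <= b)%E -> `|f t - r| <= eps.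
  move: zb; rewrite le_eqVlt => /predU1P[->|zb].
    exists 0; apply: filterE => t /andP[/lt_le_trans + tb].
    by move/(_ _ tb); rewrite ltxx.
  have [|r rP] := regulated_right rf (_ : a <= z < b)%E; first by rewrite az.
  by exists r; exact: rP.
have [l lP] : exists l : R,
    \forall t \near z, (a <= t < z)%E -> `|f t - l| <= eps.
  move: az; rewrite le_eqVlt => /predU1P[<-|az].
    exists 0; apply: filterE => t /andP[/le_lt_trans + ta].
    by move/(_ _ ta); rewrite ltxx.
  have [|l lP] := regulated_left rf (_ : a < z <= b)%E; first by rewrite az.
  by exists l; exact: lP.
have [N zN [NP MP]] : exists2 N, nbhs z N &
    (forall t, N t -> (z < t <= b)%E -> `|f t - r| <= eps) /\
    (forall t, N t -> (a <= t < z)%E -> `|f t - l| <= eps).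
  by exists [set t | ((z < t <= b)%E -> `|f t - r| <= eps) /\
     ((a <= t < z)%E -> `|f t - l| <= eps)]; [exact: filterI|split=> t []].
exists N => // x y /andP[ax xz] /andP[zy yb] xy xyN; split; first exact: ltW.
have Qadd h1 h2 : Q h1 -> Q h2 -> Q (fun t => h1 t + h2 t).
  move=> Q1 Q2; have -> : (fun t => h1 t + h2 t) = (fun t => h1 t + 1 * h2 t).
    by apply/funext => t; rewrite mul1r.
  exact: Qlin.
have Qscale k h : Q h -> Q (fun t => k * h t).
  move=> Qh; have -> : (fun t => k * h t) = (fun t => h t + (k - 1) * h t).
    by apply/funext => t; ring.
  exact: Qlin.
have Qsub h1 h2 : Q h1 -> Q h2 -> Q (fun t => h1 t - h2 t).
  move=> Q1 Q2.
  have -> : (fun t => h1 t - h2 t) = (fun t => h1 t + (-1) * h2 t).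
    by apply/funext => t; rewrite mulN1r.
  exact: Qlin.
(* When x = z only the part to the right of z is wanted, and l need not
   approximate anything. *)
exists (fun t => r * ((t <= y)%E%:R - (t <= z)%E%:R) + (x < z)%E%:R *
    (l * ((t < z)%E%:R - (t <= x)%E%:R) +
     f z * ((t <= z)%E%:R - (t < z)%E%:R))).
  by apply: (Qadd); apply: (Qscale);
    [exact: Qsub|apply: Qadd; apply: Qscale; exact: Qsub].
move=> t; case: (leP t x) => [tx|xt] /=.
  have [xz'|] := ltP x z; last first.
    by rewrite (le_trans tx (ltW xy)) (le_trans tx xz) subrr mulr0 mul0r addr0.
  rewrite (le_trans tx (ltW xy)) (le_trans tx xz) (le_lt_trans tx xz') !subrr.
  by rewrite !mulr0 addr0 mulr0 addr0.
have [ty|yt] := leP t y; last first.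
  have zt := le_lt_trans zy yt; rewrite (leNgt t z) zt /=.
  by rewrite (lt_gtF zt) !subrr !mulr0 addr0 mulr0 addr0.
have Nt : N t by apply: xyN; rewrite ty ltW.
have [tz|zt|tz] := ltgtP t z.
- have := MP t Nt; rewrite tz (le_trans ax (ltW xt)) (lt_trans xt tz) /=.
  rewrite !(subrr, mulr0, mul1r, mulr1, addr0, add0r, subr0).
  exact.
- have := NP t Nt; rewrite zt (le_trans ty yb) /=.
  rewrite !(subrr, mulr0, mul1r, mulr1, addr0, add0r, subr0).
  exact.
- rewrite -tz xt.
  rewrite !(subrr, mulr0, mul1r, mulr1, addr0, add0r, subr0) normr0.
  exact: ltW.
Qed.
Lemma regulated_bounded a b f : (a < b)%E -> regulated a b f ->
  bounded_on a b f.
Proof.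
move=> ab; move: f; apply: (@regulated_ind a b (bounded_on a b)) => //.
- by move=> c; exists 1 => // t _; case: (t < c)%E; rewrite /= ?normr1 ?normr0.
- by move=> c; exists 1 => // t _; case: (t <= c)%E; rewrite /= ?normr1 ?normr0.
- move=> k h1 h2 [M M0 hM] [N N0 hN]; exists (M + `|k| * N).
    by rewrite ltr_wpDr// mulr_ge0// ltW.
  move=> t tab; rewrite (le_trans (ler_normD _ _))// lerD ?hM//.
  by rewrite normrM ler_wpM2l// hN.
- move=> f /(_ 1 ltr01)[h [M M0 hM] fh].
  exists (1 + M); first by rewrite addr_gt0.
  move=> t tab; rewrite -[f t](subrK (h t)) (le_trans (ler_normD _ _))//.
  by rewrite lerD ?hM ?fh.
Qed.

End regulated_and_bv.

(** * Existence of Stieltjes integrals *)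

Section existence.
Context {R : realType}.
Implicit Types (a b c : \bar R) (f g h : \bar R -> R).

Definition HS_integrable a b f g : Prop := exists I : R,
  interval_sum a b (fun x z y => f z * (g y - g x)) p
    @[p --> tagged_filter a b] --> I.

Lemma HS_integrable_linl a b g k f1 f2 :
  HS_integrable a b f1 g -> HS_integrable a b f2 g ->
  HS_integrable a b (fun t => f1 t + k * f2 t) g.
Proof.
move=> [I1 cv1] [I2 cv2]; exists (I1 + k * I2).
under eq_fun.
  move=> p; have -> : (fun x z y => (f1 z + k * f2 z) * (g y - g x)) =
    (fun x z y => f1 z * (g y - g x) + k * (f2 z * (g y - g x))).
    by apply/funext => x; apply/funext => z; apply/funext => y; ring.
  rewrite interval_sum_lin; over.
by apply: cvgD => //; exact: cvgMr.
Qed.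

Lemma HS_integrable_linr a b f k g1 g2 :
  HS_integrable a b f g1 -> HS_integrable a b f g2 ->
  HS_integrable a b f (fun t => g1 t + k * g2 t).
Proof.
move=> [I1 cv1] [I2 cv2]; exists (I1 + k * I2).
under eq_fun.
  move=> p.
  have -> : (fun x z y => f z * (g1 y + k * g2 y - (g1 x + k * g2 x))) =
    (fun x z y => f z * (g1 y - g1 x) + k * (f z * (g2 y - g2 x))).
    by apply/funext => x; apply/funext => z; apply/funext => y; ring.
  rewrite interval_sum_lin; over.
by apply: cvgD => //; exact: cvgMr.
Qed.

Lemma HS_integrable_primitive a b f g phi :
  (forall eps : R, 0 < eps ->
     exists (W : \bar R -> R) (G : \bar R -> set (\bar R)),
     [/\ W b - W a <= eps, forall z, nbhs z (G z) &
      forall x z y, (a <= x <= z)%E -> (z <= y <= b)%E -> (x < y)%E ->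
        G z x -> G z y ->
        `|f z * (g y - g x) - (phi y - phi x)| <= W y - W x]) ->
  HS_integrable a b f g.
Proof. by move=> H; exists (phi b - phi a); exact: variational_cvg. Qed.

(** [phi] is an indefinite integral without error, so one gauge serves for all
    [eps]. *)
Lemma HS_integrable_exact a b f g phi (G : \bar R -> set (\bar R)) :
  (forall z, nbhs z (G z)) ->
  (forall x z y, (a <= x <= z)%E -> (z <= y <= b)%E -> (x < y)%E ->
     G z x -> G z y -> f z * (g y - g x) = phi y - phi x) ->
  HS_integrable a b f g.
Proof.
move=> Gn fg; apply: (@HS_integrable_primitive _ _ _ _ phi) => eps eps0.
exists (fun _ => 0), G; split; [by rewrite subrr ltW|exact: Gn|].
by move=> x z y xz zy xy Gx Gy; rewrite fg // !subrr normr0.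
Qed.

(** This gauge forces [c] to be the tag of each interval that contains it. *)
Definition same_side c z : set (\bar R) :=
  [set t | ((z < c)%E -> (t < c)%E) /\ ((c < z)%E -> (c < t)%E)].

Lemma nbhs_same_side c z : nbhs z (same_side c z).
Proof.
have [zc|cz|<-] := ltgtP z c; last by apply: filterE => t; split; rewrite ltxx.
  apply: filterS (nbhs_lt_ereal zc) => t; split=> // /(lt_trans zc).
  by rewrite ltxx.
apply: filterS (nbhs_gt_ereal cz) => t; split=> // /(lt_trans cz).
by rewrite ltxx.
Qed.

(** The indefinite integral is [g] up to [c], where it jumps to the left limit
    of [g].  Only the interval that contains [c] and points below it causes an
    error, charged to a jump of height [eps] at [c] of the bounding function. *)
Lemma indicator_lt_integrable a b g c : regulated a b g ->
  HS_integrable a b (fun t => (t < c)%E%:R) g.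
Proof.
move=> rg.
have [ca|ac] := leP c a.
  apply: (@HS_integrable_exact _ _ _ _ (fun _ => 0) (fun _ => setT)) 
    => [z|x z y]; first exact: filterT.
  move=> /andP[ax xz] /andP[zy yb] _ _ _.
  by rewrite ltNge (le_trans ca (le_trans ax xz)) mul0r subrr.
have [cb|bc] := leP c b; last first.
  apply: (@HS_integrable_exact _ _ _ _ g (fun _ => setT)) 
    => [z|x z y]; first exact: filterT.
  move=> /andP[ax xz] /andP[zy yb] _ _ _.
  by rewrite (le_lt_trans (le_trans zy yb) bc) mul1r.
have [|l lP] := regulated_left rg (_ : a < c <= b)%E; first by rewrite ac.
apply: (@HS_integrable_primitive _ _ _ _
  (fun t => if (t < c)%E then g t else l)) => eps eps0.
exists (fun t => eps * (c <= t)%E%:R), (fun z => same_side c z `&`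
  [set t | z = c -> (a <= t < c)%E -> `|g t - l| <= eps]); split.
- by rewrite cb (leNgt c a) ac mulr1 mulr0 subr0.
- move=> z; apply: filterI; first exact: nbhs_same_side.
  have [->|zc] := eqVneq z c; last first.
    by apply: filterE => t /eqP; rewrite (negPf zc).
  by apply: filterS (lP _ eps0) => t lt _.
- move=> x z y /andP[ax xz] /andP[zy yb] xy [[xl xr] xc] [[yl yr] yc].
  have [zc|cz|zc] := ltgtP z c.
  + rewrite xl // yl // mul1r subrr normr0.
    by rewrite (leNgt c y) (leNgt c x) xl // yl // subrr.
  + by rewrite !ltNge !(ltW (xr cz)) !(ltW (yr cz)) /= mul0r !subrr normr0.
  + have cy : (c <= y)%E by rewrite -zc.
    rewrite mul0r sub0r normrN (ltNge y c) cy /=.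
    have [xc'|cx] := ltP x c; last by rewrite !subrr normr0.
    by rewrite mulr1 mulr0 subr0 distrC; apply: xc; rewrite ?ax.
Qed.

(** As for [t < c], with the right limit of [g]; the error now comes from the
    interval that contains [c] and points above it. *)
Lemma indicator_le_integrable a b g c : regulated a b g ->
  HS_integrable a b (fun t => (t <= c)%E%:R) g.
Proof.
move=> rg.
have [ca|ac] := ltP c a.
  apply: (@HS_integrable_exact _ _ _ _ (fun _ => 0) (fun _ => setT)) 
    => [z|x z y]; first exact: filterT.
  move=> /andP[ax xz] /andP[zy yb] _ _ _.
  by rewrite leNgt (lt_le_trans ca (le_trans ax xz)) mul0r subrr.
have [cb|bc] := ltP c b; last first.
  apply: (@HS_integrable_exact _ _ _ _ g (fun _ => setT)) 
    => [z|x z y]; first exact: filterT.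
  move=> /andP[ax xz] /andP[zy yb] _ _ _.
  by rewrite (le_trans (le_trans zy yb) bc) mul1r.
have [|r rP] := regulated_right rg (_ : a <= c < b)%E; first by rewrite ac.
apply: (@HS_integrable_primitive _ _ _ _
  (fun t => if (t <= c)%E then g t else r)) => eps eps0.
exists (fun t => eps * (c < t)%E%:R), (fun z => same_side c z `&`
  [set t | z = c -> (c < t <= b)%E -> `|g t - r| <= eps]); split.
- by rewrite cb (ltNge c a) ac mulr1 mulr0 subr0.
- move=> z; apply: filterI; first exact: nbhs_same_side.
  have [->|zc] := eqVneq z c; last first.
    by apply: filterE => t /eqP; rewrite (negPf zc).
  by apply: filterS (rP _ eps0) => t lt _.
- move=> x z y /andP[ax xz] /andP[zy yb] xy [[xl xr] xc] [[yl yr] yc].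
  have [zc|cz|zc] := ltgtP z c.
  + by rewrite !(ltNge c) !(ltW (xl zc)) !(ltW (yl zc)) mul1r !subrr normr0.
  + rewrite (lt_geF (xr cz)) (lt_geF (yr cz)) (xr cz) (yr cz).
    by rewrite mul0r !subrr normr0.
  + have xc' : (x <= c)%E by rewrite -zc.
    rewrite mul1r (ltNge c x) xc' /= mulr0 subr0.
    have [y_c|cy] := leP y c; first by rewrite subrr normr0 mulr0.
    rewrite mulr1.
    have -> : g y - g x - (r - g x) = g y - r by ring.
    by apply: yc => //; rewrite cy.
Qed.

(** Only intervals that contain [c] contribute, and their tag is [c]: each term
    is an increment of [f c * h], whatever [f] is. *)
Lemma integrable_step_integrator a b f h c :
  (forall t, (t < c)%E -> h t = 1) -> (forall t, (c < t)%E -> h t = 0) ->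
  HS_integrable a b f h.
Proof.
move=> hl hr.
apply: (@HS_integrable_exact _ _ _ _ (fun t => f c * h t) (same_side c)).
  exact: nbhs_same_side.
move=> x z y _ _ _ [xl xr] [yl yr]; have [zc|cz|->] := ltgtP z c.
- by rewrite !hl ?xl ?yl// !subrr mulr0.
- by rewrite !hr ?xr ?yr// !subrr mulr0.
- by rewrite mulrBr.
Qed.

(** Replacing [f] by [h] changes the sums by at most [sup |f - h|] times the
    total increment of [V]. *)
Lemma HS_integrable_approxl a b f g V : dominated a b g V ->
  (forall eps : R, 0 < eps -> exists2 h, HS_integrable a b h g &
     forall t, (a <= t <= b)%E -> `|f t - h t| <= eps) ->
  HS_integrable a b f g.
Proof.
move=> gV fh; apply: cvg_near_limit => eps eps0.
have D0 : 0 < `|V b - V a| + 1 by rewrite ltr_wpDl.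
have [h hI hf] := fh _ (divr_gt0 eps0 D0).
eexists; split; first exact: hI.
suff : \forall p \near tagged_filter a b,
    `|interval_sum a b (fun x z y => f z * (g y - g x) - h z * (g y - g x)) p|
      <= eps / (`|V b - V a| + 1) * V b - eps / (`|V b - V a| + 1) * V a.
  apply: filterS => p; rewrite -interval_sumB => /le_trans; apply.
  rewrite -mulrBr mulrAC ler_pdivrMr// ler_wpM2l ?(ltW eps0)//.
  by rewrite (le_trans (ler_norm _))// lerDl.
apply: (@near_interval_sum_le _ a b _ (fun t => _ * V t) (fun _ => setT)).
  by move=> z; exact: filterT.
move=> x z y /andP[ax xz] /andP[zy yb] xy _ _.
rewrite -mulrBl -mulrBr normrM ler_pM//.
  by apply: hf; rewrite (le_trans ax xz) (le_trans zy yb).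
by apply: gV => //; exact: ltW.
Qed.

(** Summation by parts: up to increments of [f * (g - h)], the terms of
    [f d(g - h)] are products of [g - h] with increments of [f]. *)
Lemma HS_integrable_approxr a b f g V : dominated a b f V ->
  (forall eps : R, 0 < eps -> exists2 h, HS_integrable a b f h &
     forall t, (a <= t <= b)%E -> `|g t - h t| <= eps) ->
  HS_integrable a b f g.
Proof.
move=> fV gh; apply: cvg_near_limit => eps eps0.
have D0 : 0 < `|V b - V a| + 1 by rewrite ltr_wpDl.
have [h [I hI] hg] := gh _ (divr_gt0 eps0 D0).
pose phi t := f t * (g t - h t).
exists (fun p => interval_sum a b (fun x z y => f z * (h y - h x)) p +
  (phi b - phi a)); split.
  by exists (I + (phi b - phi a)); apply: cvgD => //; exact: cvg_cst.
suff : \forall p \near tagged_filter a b,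
    `|interval_sum a b (fun x z y => f z * (g y - g x) - f z * (h y - h x)) p -
      (phi b - phi a)|
      <= eps / (`|V b - V a| + 1) * V b - eps / (`|V b - V a| + 1) * V a.
  apply: filterS => p; rewrite -interval_sumB => le_p.
  rewrite (opprD (interval_sum _ _ _ _)) addrA.
  apply: le_trans le_p _.
  rewrite -mulrBr mulrAC ler_pdivrMr// ler_wpM2l ?(ltW eps0)//.
  by rewrite (le_trans (ler_norm _))// lerDl.
apply: (@near_interval_sum_primitive _ a b _ phi (fun t => _ * V t)
  (fun _ => setT)).
  by move=> z; exact: filterT.
move=> x z y /andP[ax xz] /andP[zy yb] xy _ _.
have -> : f z * (g y - g x) - f z * (h y - h x) - (phi y - phi x) =
   - ((g y - h y) * (f y - f z) + (g x - h x) * (f z - f x)).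
  by rewrite /phi; ring.
have -> : forall k, k * V y - k * V x = k * (V y - V z) + k * (V z - V x).
  by move=> k; ring.
have az := le_trans ax xz; have zb := le_trans zy yb.
rewrite normrN (le_trans (ler_normD _ _))// !normrM lerD// ler_pM//.
- by apply: hg; rewrite (le_trans az zy) yb.
- exact: fV.
- by apply: hg; rewrite ax (le_trans xz zb).
- exact: fV.
Qed.

Lemma regulated_dominated_integrable a b f g V : (a < b)%E ->
  regulated a b f -> dominated a b g V -> HS_integrable a b f g.
Proof.
move=> ab rf gV; have rg := dominated_regulated gV; move: f rf.
apply: (@regulated_ind _ a b (fun f => HS_integrable a b f g)) => //.
- by move=> c; exact: indicator_lt_integrable.
- by move=> c; exact: indicator_le_integrable.
- by move=> k h1 h2; exact: HS_integrable_linl.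
- by move=> f; exact: HS_integrable_approxl gV.
Qed.

Lemma dominated_regulated_integrable a b f g V : (a < b)%E ->
  dominated a b f V -> regulated a b g -> HS_integrable a b f g.
Proof.
move=> ab fV; move: g.
apply: (@regulated_ind _ a b (fun g => HS_integrable a b f g)) => //.
- move=> c; apply: (@integrable_step_integrator _ _ _ _ c) => t tc.
    by rewrite tc.
  by rewrite ltNge ltW.
- move=> c; apply: (@integrable_step_integrator _ _ _ _ c) => t tc.
    by rewrite ltW.
  by rewrite leNgt tc.
- by move=> k h1 h2; exact: HS_integrable_linr.
- by move=> g; exact: HS_integrable_approxr fV.
Qed.
End existence.

(** * The product formula *)

Section product.
Context {R : realType}.
Implicit Types (a b c : \bar R) (f g h A B C V : \bar R -> R).

Definition finite_jumps a b f := forall delta : R, 0 < delta ->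
  exists F : seq (\bar R), forall z, (a <= z <= b)%E -> z \notin F ->
    \forall t \near z, (a <= t <= b)%E -> `|f t - f z| <= delta.

Lemma regulated_finite_jumps a b f : (a < b)%E -> regulated a b f ->
  finite_jumps a b f.
Proof.
move=> ab; move: f; apply: (@regulated_ind _ a b (finite_jumps a b)) => //.
- move=> c d d0; exists [:: c] => z _; rewrite inE => zc.
  apply: filterS (nbhs_same_side c z) => t [tl tr] _.
  have [zc'|cz|zc'] := ltgtP z c; last by rewrite zc' eqxx in zc.
    by rewrite tl// subrr normr0 ltW.
  by rewrite lt_gtF ?tr// subrr normr0 ltW.
- move=> c d d0; exists [:: c] => z _; rewrite inE => zc.
  apply: filterS (nbhs_same_side c z) => t [tl tr] _.
  have [zc'|cz|zc'] := ltgtP z c; last by rewrite zc' eqxx in zc.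
    by rewrite (ltW (tl zc')) subrr normr0 ltW.
  by rewrite (lt_geF (tr cz)) subrr normr0 ltW.
- move=> k h1 h2 H1 H2 d d0.
  have k0 : 0 < `|k| + 1 by rewrite ltr_wpDl.
  have d2 : 0 < d / 2 by rewrite divr_gt0.
  have [F1 HF1] := H1 _ d2; have [F2 HF2] := H2 _ (divr_gt0 d2 k0).
  exists (F1 ++ F2) => z zab; rewrite mem_cat negb_or => /andP[z1 z2].
  apply: filterS2 (HF1 _ zab z1) (HF2 _ zab z2) => t t1 t2 tab.
  have -> : h1 t + k * h2 t - (h1 z + k * h2 z) =
    (h1 t - h1 z) + k * (h2 t - h2 z) by ring.
  rewrite (le_trans (ler_normD _ _))// (splitr d) lerD ?t1//.
  rewrite normrM (le_trans (ler_wpM2l (normr_ge0 _) (t2 tab)))//.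
  by rewrite mulrCA ler_piMr ?(ltW d2)// ler_pdivrMr// mul1r lerDl.
- move=> f fh d d0.
  have d3 : 0 < d / 3 by rewrite divr_gt0.
  have [h Hh {}fh] := fh _ d3; have [F HF] := Hh _ d3.
  exists F => z zab zF; apply: filterS (HF _ zab zF) => t ht tab.
  have -> : f t - f z = (f t - h t) + (h t - h z) - (f z - h z) by ring.
  have -> : d = d / 3 + d / 3 + d / 3 by field.
  rewrite (le_trans (ler_normB _ _))// lerD ?fh//.
  by rewrite (le_trans (ler_normD _ _))// lerD ?fh ?ht.
Qed.

(** It grows by at least 1 on an interval that contains a point of [F], and by
    at most 2 for each point of [F] in total: a device that bounds the number
    of intervals tagged in [F] by a telescoping sum.  Each point counts twice
    because it may be an endpoint, and the tag, of two adjacent intervals. *)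
Definition passage_count (F : seq (\bar R)) (t : \bar R) : R :=
  \sum_(c <- F) ((c <= t)%E%:R + (c < t)%E%:R).

Lemma passage_count_le F x y : (x <= y)%E ->
  passage_count F x <= passage_count F y.
Proof.
move=> xy; apply: ler_sum => c _; apply: lerD; rewrite ler_nat.
  by case: (leP c x) => // cx; rewrite (le_trans cx xy).
by case: (ltP c x) => // cx; rewrite (lt_le_trans cx xy).
Qed.

Lemma passage_count_ge1 F x z y : z \in F -> (x <= z <= y)%E -> (x < y)%E ->
  1 <= passage_count F y - passage_count F x.
Proof.
elim: F => // c F IH; rewrite inE => zF xzy xy.
rewrite /passage_count !big_cons opprD addrACA.
have cxy := @passage_count_le [:: c] _ _ (ltW xy).
rewrite /passage_count !big_seq1 -subr_ge0 in cxy.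
move: zF => /predU1P[zc|zF]; last by rewrite ler_wpDl// IH.
rewrite ler_wpDr ?subr_ge0 ?passage_count_le ?(ltW xy)//.
move: xzy; rewrite zc => /andP[xc cy].
rewrite cy (ltNge c x) xc /= addr0.
have [cx|xc'] := leP c x; first by rewrite (le_lt_trans cx xy) addrK.
by rewrite subr0 lerDl.
Qed.

Lemma passage_count_total F a b :
  passage_count F b - passage_count F a <= 2 * (size F)%:R.
Proof.
elim: F => [|c F IH]; first by rewrite /passage_count !big_nil subrr mulr0.
rewrite /passage_count !big_cons -/(passage_count F a) -/(passage_count F b).
rewrite [size _]/= -natr1; move: IH.
by case: (c <= b)%E; case: (c < b)%E; case: (c <= a)%E; case: (c < a)%E => /=;
  lra.
Qed.

Definition continuous_in a b f z := forall eps : R, 0 < eps ->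
  \forall t \near z, (a <= t <= b)%E -> `|f t - f z| <= eps.

Lemma not_discontinuous_at a b f z : ~ discontinuous_at a b f z ->
  continuous_in a b f z.
Proof.
move=> /contrapT /cvgrPdist_le fz eps /fz {}fz.
have {}fz : \forall t \near z, [set` `[a, b]] t -> `|f z - f t| <= eps := fz.
by apply: filterS fz => t fz tab; rewrite distrC; apply: fz; rewrite /= in_itv.
Qed.

(** The bound on the sums is split into two halves of [eps]: one pays for
    the tags at which [C] moves by at most [delta], the other for the
    exceptional tags in [F], at which [B] moves by at most [eta]. *)
Lemma joint_increments_cvg0 a b A B C V : (a < b)%E ->
  bounded_on a b A -> dominated a b B V -> regulated a b C ->
  (forall z, (a <= z <= b)%E ->
     continuous_in a b B z \/ continuous_in a b C z) ->
  interval_sum a b (fun x z y =>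
    A z * ((B y - B z) * (C y - C z) - (B x - B z) * (C x - C z))) p
    @[p --> tagged_filter a b] --> (0 : R).
Proof.
move=> ab [M M0 AM] BV rC BC.
have [K K0 CK] := regulated_bounded ab rC.
set e := (fun x z y => A z * _).
have := @variational_cvg R a b e (fun _ => 0); rewrite subrr; apply=> eps eps0.
have VT : 0 <= V b - V a by rewrite subr_ge0 (dominated_le BV) ?(ltW ab) ?lexx.
have e2 : 0 < eps / 2 by rewrite divr_gt0.
pose T1 := V b - V a + 1; have T0 : 0 < T1 by rewrite ltr_wpDl.
pose delta := eps / 2 / (M * T1).
have d0 : 0 < delta by rewrite divr_gt0// mulr_gt0.
have [F HF] := regulated_finite_jumps ab rC d0.
pose kappa := eps / 2 / (2 * (size F)%:R + 1).
have m0 : 0 < 2 * (size F)%:R + 1 :> R by rewrite ltr_wpDl// mulr_ge0.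
have k0 : 0 < kappa by rewrite divr_gt0.
(* An exceptional interval has two products, each at most eta * (2 * K) in
   absolute value, and these are multiplied by M. *)
pose eta := kappa / (4 * M * K).
have eta0 : 0 < eta by rewrite divr_gt0// !mulr_gt0.
have /choice[G HG] z : exists N, nbhs z N /\ ((a <= z <= b)%E ->
    (forall t, N t -> (a <= t <= b)%E -> `|C t - C z| <= delta) \/
    z \in F /\ (forall t, N t -> (a <= t <= b)%E -> `|B t - B z| <= eta)).
  have [zab|_] := boolP (a <= z <= b)%E; last first.
    by exists setT; split=> //; exact: filterT.
  have [zF|zF] := boolP (z \in F); last first.
    by eexists; split; [exact: (HF _ zab zF)|move=> _; left].
  have [Bz|Cz] := BC _ zab.
    by eexists; split; [exact: (Bz _ eta0)|move=> _; right].
  by eexists; split; [exact: (Cz _ d0)|move=> _; left].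
exists (fun t => M * delta * V t + kappa * passage_count F t), G; split.
- have -> : M * delta * V b + kappa * passage_count F b -
     (M * delta * V a + kappa * passage_count F a) =
     M * delta * (V b - V a) + kappa * (passage_count F b - passage_count F a).
    by ring.
  rewrite (splitr eps) lerD//.
    have -> : M * delta * (V b - V a) = eps / 2 * ((V b - V a) / T1).
      by rewrite /delta; field; rewrite !gt_eqF.
    by rewrite ler_piMr ?(ltW e2)// ler_pdivrMr// mul1r lerDl.
  rewrite /kappa mulrAC ler_pdivrMr// ler_wpM2l ?(ltW e2)//.
  by rewrite (le_trans (passage_count_total _ _ _))// lerDl.
- by move=> z; have [] := HG z.
- move=> x z y /andP[ax xz] /andP[zy yb] xy Gx Gy.
  have az := le_trans ax xz; have zb := le_trans zy yb.
  have xab : (a <= x <= b)%E by rewrite ax (le_trans xz).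
  have yab : (a <= y <= b)%E by rewrite yb (le_trans az).
  have zab : (a <= z <= b)%E by rewrite az zb.
  rewrite /= ?subrr subr0 /e.
  have -> : M * delta * V y + kappa * passage_count F y -
     (M * delta * V x + kappa * passage_count F x) =
     M * (delta * (V y - V x)) +
     kappa * (passage_count F y - passage_count F x) by ring.
  have Vxy : 0 <= V y - V x by rewrite subr_ge0 (dominated_le BV)// ltW.
  have Pxy : 0 <= passage_count F y - passage_count F x.
    by rewrite subr_ge0 passage_count_le// ltW.
  rewrite normrM; have [_ /(_ zab)[Cd|[zF Be]]] := HG z.
    apply: ler_wpDr; first by rewrite mulr_ge0// ltW.
    apply: ler_pM => //; first exact: AM.
    have -> : V y - V x = (V y - V z) + (V z - V x) by ring.
    rewrite (mulrDr delta) (le_trans (ler_normB _ _))// !normrM.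
    rewrite ![`|B _ - _| * _]mulrC lerD// ler_pM ?Cd//.
      exact: BV.
    by rewrite distrC; exact: BV.
  have C2 s t : (a <= s <= b)%E -> (a <= t <= b)%E -> `|C s - C t| <= 2 * K.
    move=> sab tab; rewrite (le_trans (ler_normB _ _))//.
    by have := CK _ sab; have := CK _ tab; lra.
  apply: ler_wpDl; first exact: mulr_ge0 (ltW M0) (mulr_ge0 (ltW d0) Vxy).
  apply: (@le_trans _ _ kappa); last first.
    by rewrite ler_peMr ?(ltW k0)// (passage_count_ge1 zF)// xz.
  have -> : kappa = M * (eta * (2 * K) + eta * (2 * K)).
    by rewrite /eta; field; rewrite !gt_eqF.
  rewrite ler_pM ?AM// (le_trans (ler_normB _ _))// !normrM.
  by rewrite lerD// ler_pM ?Be ?C2.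
Qed.


Lemma HS_integral_product a b A B C V : (a < b)%E ->
  bounded_on a b A -> dominated a b B V -> regulated a b C ->
  (forall z, (a <= z <= b)%E ->
     continuous_in a b B z \/ continuous_in a b C z) ->
  HS_integrable a b (A \* B) C -> HS_integrable a b (A \* C) B ->
  exists I J K : R,
    [/\ is_HS_integral a b A (B \* C) I,
        is_HS_integral a b (A \* B) C J,
        is_HS_integral a b (A \* C) B K
      & I = J + K].
Proof.
move=> ab bA BV rC BC [J HJ] [K HK].
have E0 := joint_increments_cvg0 ab bA BV rC BC.
exists (J + K), J, K; split=> //; apply/is_HS_integralP => //.
rewrite -[J + K]addr0; apply: cvg_trans (cvgD (cvgD HJ HK) E0).
apply: near_eq_cvg; apply: filterE => p.
rewrite !fctE /interval_sum /= -!big_split; apply: eq_bigr => n _ /=; ring.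
Qed.

End product.

Unset Implicit Arguments.

Theorem proposition6p2 (R : realType) (a b : \bar R) (A B C : \bar R -> R)
    (hab : (a < b)%E)
    (hABC : [\/ [/\ ebounded_variation a b A, ebounded_variation a b B
                  & regulated a b C],
                [/\ ebounded_variation a b A, ebounded_variation a b C
                  & regulated a b B]
              | [/\ ebounded_variation a b B, ebounded_variation a b C
                  & regulated a b A] ])
    (hBC : ~ exists x : \bar R, [/\ (a <= x <= b)%E,
             discontinuous_at a b B x & discontinuous_at a b C x]) :
  exists I J K : R,
    [/\ is_HS_integral a b A (B \* C) I,
        is_HS_integral a b (A \* B) C J,
        is_HS_integral a b (A \* C) B K
      & I = J + K].
Proof.
have BC z : (a <= z <= b)%E -> continuous_in a b B z \/ continuous_in a b C z.
  move=> zab.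
  have [dB|/not_discontinuous_at] := pselect (discontinuous_at a b B z);
    last by left.
  have [dC|/not_discontinuous_at] := pselect (discontinuous_at a b C z);
    last by right.
  by case: hBC; exists z.
case: hABC => -[].
- move=> /bounded_variation_dominated[V AV].
  move=> /bounded_variation_dominated[W BW] rC.
  have [U ABU] := dominated_mul AV BW.
  apply: (HS_integral_product hab (dominated_bounded AV) BW rC BC).
    exact: dominated_regulated_integrable ABU rC.
  apply: regulated_dominated_integrable BW => //.
  exact: regulated_mul (dominated_regulated AV) rC.
- move=> /bounded_variation_dominated[V AV].
  move=> /bounded_variation_dominated[W CW] rB.
  have [U ACU] := dominated_mul AV CW.
  have CB z : (a <= z <= b)%E -> continuous_in a b C z \/ continuous_in a b B z.
    by move=> /BC[]; [right|left].
  have BCE : B \* C = C \* B by apply/funext => t /=; rewrite mulrC.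
  have [||I [K [J [HI HK HJ IE]]]] :=
    HS_integral_product hab (dominated_bounded AV) CW rB CB.
  + exact: dominated_regulated_integrable ACU rB.
  + apply: regulated_dominated_integrable CW => //.
    exact: regulated_mul (dominated_regulated AV) rB.
  by exists I, J, K; split=> //; rewrite ?BCE// IE addrC.
- move=> /bounded_variation_dominated[V BV].
  move=> /bounded_variation_dominated[W CW] rA.
  have rB := dominated_regulated BV; have rC := dominated_regulated CW.
  apply: (HS_integral_product hab (regulated_bounded hab rA) BV rC BC).
    by apply: regulated_dominated_integrable CW => //; exact: regulated_mul.
  by apply: regulated_dominated_integrable BV => //; exact: regulated_mul.
Qed.
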